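(* Let $\tilde K\in\mathbb{R}^{n_u\times n_x}$, $\tilde P=\tilde P^\top\in\mathbb{R}^{n_x\times n_x}$ with $\tilde P\succ0$, and $\tilde\lambda>0$ be such that $(K,P,\lambda)=(\tilde K,\tilde P,\tilde\lambda)$ satisfies $$\mathcal{H}\left(P{\boldsymbol{\delta}^*}^\top\begin{bmatrix}I\\ K\end{bmatrix}\right)+\lambda PP+\frac1\lambda\begin{bmatrix}I\\ K\end{bmatrix}^\top{\mathbf{A}^*}^{-1}\begin{bmatrix}I\\ K\end{bmatrix}+(C+DK)^\top(C+DK)\prec0.\qquad(\mathrm{S}_2)$$ Let $\beta>0$ and consider the optimization problem in the variables $\gamma\ge 0$, $K\in\mathbb{R}^{n_u\times n_x}$, symmetric $P\in\mathbb{R}^{n_x\times n_x}$, symmetric $Z\in\mathbb{R}^{n_d\times n_d}$, and $\lambda\in\mathbb{R}$: $$(\mathrm{R}_2)\quad\min_{\gamma,K,P,Z,\lambda}\ \gamma+\beta\|K\circ I_{S^c}\|_F^2\quad\text{subject to}$$ $$\begin{bmatrix}-\frac12L(K,P|\tilde K,\tilde P)&*&*&*&*\\ \frac1{\sqrt2}\left(\boldsymbol{\delta}^*P+\begin{bmatrix}I\\ K\end{bmatrix}\right)&-I&*&*&*\\ \begin{bmatrix}I\\ K\end{bmatrix}&0&-\lambda\mathbf{A}^*&*&*\\ P&0&0&\Lambda&*\\ C+DK&0&0&0&-I\end{bmatrix}\prec0,\qquad \Lambda=\left(-\frac1{\tilde\lambda}+\frac1{\tilde\lambda^2}(\lambda-\tilde\lambda)\right)I,$$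 $$P\succ0,\quad Z-G^\top PG\succeq0,\quad \mathrm{Tr}(Z)\le\gamma^2,\quad\lambda>0.$$ Then Problem $(\mathrm{R}_2)$ is feasible, and for any optimal solution of $(\mathrm{R}_2)$, its components $(K^*,P^*,\lambda^* )$ are feasible for $(\mathrm{S}_2)$ (that is, $P^*\succ0$, $\lambda^*>0$, and $(K,P,\lambda)=(K^*,P^*,\lambda^* )$ satisfies $(\mathrm{S}_2)$).
   Context: Notation: $\mathcal{H}(X)=X+X^\top$; $\circ$ is the elementwise product; $\|\cdot\|_F$ is the Frobenius norm; $\mathrm{Tr}$ is the trace; $M\succ0$ ($\succeq 0$, $\prec 0$, $\preceq 0$) means symmetric positive definite (positive semidefinite, negative definite, negative semidefinite); $I$ and $0$ are identity and zero matrices of appropriate size; $*$ denotes blocks determined by symmetry. In $\begin{bmatrix}I\\ K\end{bmatrix}\in\mathbb{R}^{(n_x+n_u)\times n_x}$ the identity is $n_x\times n_x$. Structure: $S\subseteq\mathbb{R}^{n_u\times n_x}$ is the linear subspace of matrices with a prescribed sparsity pattern. $I_S$ is the $0/1$ matrix with $[I_S]_{ij}=0$ if $K_{ij}=0$ is required and $[I_S]_{ij}=1$ if $K_{ij}$ is free. $I_{S^c}=\mathbf{1}_{n_u\times n_x}-I_S$, where $\mathbf{1}$ is the all-one matrix. Thus $K\in S$ iff $K\circ I_{S^c}=0$. System and data: the system is $\dot x(t)=Ax(t)+Bu(t)+Gd(t)$, $y(t)=Cx(t)+Du(t)+Hd(t)$, with $x\in\mathbb{R}^{n_x}$, $u\in\mathbb{R}^{n_u}$,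 $d\in\mathbb{R}^{n_d}$, $y\in\mathbb{R}^{n_y}$; $(A,B)$ is unknown and stabilizable; $C\in\mathbb{R}^{n_y\times n_x}$, $D\in\mathbb{R}^{n_y\times n_u}$, $G\in\mathbb{R}^{n_x\times n_d}$ are given; $\|d(t)\|_2\le\epsilon$ for all $t>0$ and some $\epsilon>0$. Samples $x(t_i),u(t_i),\dot x(t_i)$, $i=0,\dots,T-1$, are collected. Define $$c_i=\dot x(t_i)\dot x(t_i)^\top-\epsilon^2GG^\top,\quad b_i=-\begin{bmatrix}x(t_i)\\ u(t_i)\end{bmatrix}\dot x(t_i)^\top,\quad a_i=\begin{bmatrix}x(t_i)\\ u(t_i)\end{bmatrix}\begin{bmatrix}x(t_i)\\ u(t_i)\end{bmatrix}^\top.$$ The matrices $\mathbf{A}^*\in\mathbb{R}^{(n_x+n_u)\times(n_x+n_u)}$ (symmetric, $\mathbf{A}^*\succ0$) and $\mathbf{B}^*\in\mathbb{R}^{(n_x+n_u)\times n_x}$ are a solution $(\mathbf{A},\mathbf{B})$ of $$\min_{\mathbf{A},\mathbf{B},\theta_0,\dots,\theta_{T-1}}-\log\det(\mathbf{A})\ \text{ s.t. }\ \begin{bmatrix}-I&\mathbf{B}^\top&\mathbf{B}^\top\\ \mathbf{B}&\mathbf{A}&0\\ \mathbf{B}&0&-\mathbf{A}\end{bmatrix}-\begin{bmatrix}\sum_{i=0}^{T-1}\theta_i\begin{bmatrix}c_i&b_i^\top\\ b_i&a_i\end{bmatrix}&0\\ 0&0\end{bmatrix}\preceq0,\ \mathbf{A}\succ0,\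 \theta_i\ge0\ (i=0,\dots,T-1),$$ and $\boldsymbol{\delta}^*=-{\mathbf{A}^*}^{-1}\mathbf{B}^*\in\mathbb{R}^{(n_x+n_u)\times n_x}$. Linearization: for given $\tilde K,\tilde P$, $$L(K,P|\tilde K,\tilde P)=\left(\boldsymbol{\delta}^*\tilde P-\begin{bmatrix}I\\ \tilde K\end{bmatrix}\right)^\top\left(\boldsymbol{\delta}^*\tilde P-\begin{bmatrix}I\\ \tilde K\end{bmatrix}\right)+\mathcal{H}\left(\left(\boldsymbol{\delta}^*\tilde P-\begin{bmatrix}I\\ \tilde K\end{bmatrix}\right)^\top\left(\boldsymbol{\delta}^*(P-\tilde P)-\begin{bmatrix}0\\ K-\tilde K\end{bmatrix}\right)\right).$$ *)

(* Defs.v *)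
From HB Require Import structures.
From mathcomp Require Import all_boot all_order all_algebra.
From mathcomp Require Import complex.
From mathcomp Require Import all_classical all_reals all_analysis.

Set Implicit Arguments.
Unset Strict Implicit.
Unset Printing Implicit Defensive.

Import Order.TTheory GRing.Theory Num.Theory.
Import numFieldNormedType.Exports.

Local Open Scope ring_scope.

Section Matrices.
Variable R : realType.

Definition qform n (M : 'M[R]_n) (v : 'cV[R]_n) : R := (v^T *m M *m v) 0 0.

Definition posdef n (M : 'M[R]_n) : Prop :=
  M^T = M /\ forall v : 'cV[R]_n, v != 0 -> 0 < qform M v.

Definition possemidef n (M : 'M[R]_n) : Prop :=
  M^T = M /\ forall v : 'cV[R]_n, 0 <= qform M v.

Definition negdef n (M : 'M[R]_n) : Prop :=
  M^T = M /\ forall v : 'cV[R]_n, v != 0 -> qform M v < 0.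

Definition negsemidef n (M : 'M[R]_n) : Prop :=
  M^T = M /\ forall v : 'cV[R]_n, qform M v <= 0.

Definition calH n (X : 'M[R]_n) : 'M[R]_n := X + X^T.

(* On a column vector this is the Euclidean norm; the norm `|M| that
   MathComp-Analysis puts on matrices is the max norm. *)
Definition frob m n (M : 'M[R]_(m, n)) : R :=
  Num.sqrt (\sum_i \sum_j M i j ^+ 2).

Definition hadamard m n (M N : 'M[R]_(m, n)) : 'M[R]_(m, n) :=
  map2_mx *%R M N.

(* A sparsity pattern is given by [free], where [free i j] says that the entry
   (i, j) is unconstrained and [~~ free i j] that it is required to vanish. *)
Definition maskS m n (free : 'I_m -> 'I_n -> bool) : 'M[R]_(m, n) :=
  \matrix_(i, j) (free i j)%:R.

Definition maskSc m n (free : 'I_m -> 'I_n -> bool) : 'M[R]_(m, n) :=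
  const_mx 1 - maskS free.

End Matrices.

Section System.
Variables (R : realType) (nx nu nd ny : nat).

Definition hurwitz (M : 'M[R]_nx) : Prop :=
  forall z : R[i], eigenvalue (map_mx (real_complex R) M) z -> complex.Re z < 0.

Definition stabilizable (A : 'M[R]_nx) (B : 'M[R]_(nx, nu)) : Prop :=
  exists F : 'M[R]_(nu, nx), hurwitz (A + B *m F).

(* Signals are total functions of time, but only their values at times t >= 0
   are constrained. Asking for a two-sided derivative at 0 is harmless: a
   signal with a right derivative at 0 can be extended affinely to t < 0. *)
Definition trajectory (A : 'M[R]_nx) (B : 'M[R]_(nx, nu))
    (G : 'M[R]_(nx, nd)) (C : 'M[R]_(ny, nx)) (D : 'M[R]_(ny, nu))
    (H : 'M[R]_(ny, nd)) (x xdot : R -> 'cV[R]_nx) (u : R -> 'cV[R]_nu)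
    (d : R -> 'cV[R]_nd) (y : R -> 'cV[R]_ny) : Prop :=
  forall t : R, 0 <= t ->
    [/\ forall i, is_derive t 1 (fun s => x s i 0) (xdot t i 0),
        xdot t = A *m x t + B *m u t + G *m d t
      & y t = C *m x t + D *m u t + H *m d t].

End System.

Section Data.
Variables (R : realType) (nx nu nd T : nat).
Variables (G : 'M[R]_(nx, nd)) (eps : R).
Variables (xs : 'I_T -> 'cV[R]_nx) (us : 'I_T -> 'cV[R]_nu)
  (xdots : 'I_T -> 'cV[R]_nx).

Definition data_c i : 'M[R]_nx :=
  xdots i *m (xdots i)^T - eps ^+ 2 *: (G *m G^T).

Definition data_b i : 'M[R]_(nx + nu, nx) :=
  - (col_mx (xs i) (us i) *m (xdots i)^T).

Definition data_a i : 'M[R]_(nx + nu) :=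
  col_mx (xs i) (us i) *m (col_mx (xs i) (us i))^T.

Definition logdet_lmi (bA : 'M[R]_(nx + nu)) (bB : 'M[R]_(nx + nu, nx))
    (theta : 'I_T -> R) : 'M[R]_(nx + (nx + nu) + (nx + nu)) :=
  block_mx (block_mx (- 1%:M) bB^T
                     bB       bA)   (col_mx bB^T 0)
           (row_mx bB 0)            (- bA)
  - block_mx (\sum_(i < T) theta i *: block_mx (data_c i) (data_b i)^T
                                               (data_b i) (data_a i)) 0
             0 0.

Definition logdet_feasible (bA : 'M[R]_(nx + nu)) (bB : 'M[R]_(nx + nu, nx))
    (theta : 'I_T -> R) : Prop :=
  [/\ negsemidef (logdet_lmi bA bB theta),
      posdef bA
    & forall i, 0 <= theta i].

Definition logdet_solution (bA : 'M[R]_(nx + nu)) (bB : 'M[R]_(nx + nu, nx))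
    : Prop :=
  exists2 theta, logdet_feasible bA bB theta &
    forall bA' bB' theta', logdet_feasible bA' bB' theta' ->
      - ln (\det bA) <= - ln (\det bA').

End Data.

Section Design.
Variables (R : realType) (nx nu nd ny : nat).
Variables (bA : 'M[R]_(nx + nu)) (bB : 'M[R]_(nx + nu, nx)).
Variables (G : 'M[R]_(nx, nd)) (C : 'M[R]_(ny, nx)) (D : 'M[R]_(ny, nu)).

Definition delta : 'M[R]_(nx + nu, nx) := - (invmx bA *m bB).

Definition IK (K : 'M[R]_(nu, nx)) : 'M[R]_(nx + nu, nx) := col_mx 1%:M K.

Definition S2_mx (K : 'M[R]_(nu, nx)) (P : 'M[R]_nx) (lam : R) : 'M[R]_nx :=
  calH (P *m delta^T *m IK K) + lam *: (P *m P)
  + lam^-1 *: ((IK K)^T *m invmx bA *m IK K)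
  + (C + D *m K)^T *m (C + D *m K).

Definition S2_feasible (K : 'M[R]_(nu, nx)) (P : 'M[R]_nx) (lam : R) : Prop :=
  [/\ posdef P, 0 < lam & negdef (S2_mx K P lam)].

Variables (Kt : 'M[R]_(nu, nx)) (Pt : 'M[R]_nx) (lamt : R).

Definition linL (K : 'M[R]_(nu, nx)) (P : 'M[R]_nx) : 'M[R]_nx :=
  let W := delta *m Pt - IK Kt in
  W^T *m W
  + calH (W^T *m (delta *m (P - Pt) - col_mx (0 : 'M[R]_nx) (K - Kt))).

Definition Lambda (lam : R) : 'M[R]_nx :=
  (- lamt^-1 + (lamt ^+ 2)^-1 * (lam - lamt))%:M.

(* The 5 x 5 block matrix, split as 1 + 4 blocks: [R2_col] stacks the blocks
   below the upper left one, and [R2_diag] is the block diagonal remainder. *)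
Definition R2_col (K : 'M[R]_(nu, nx)) (P : 'M[R]_nx)
    : 'M[R]_((nx + nu) + ((nx + nu) + (nx + ny)), nx) :=
  col_mx ((Num.sqrt 2)^-1 *: (delta *m P + IK K))
  (col_mx (IK K)
  (col_mx P
          (C + D *m K))).

Definition R2_diag (lam : R)
    : 'M[R]_((nx + nu) + ((nx + nu) + (nx + ny))) :=
  block_mx (- 1%:M) 0 0
  (block_mx (- (lam *: bA)) 0 0
  (block_mx (Lambda lam) 0 0
            (- 1%:M))).

Definition R2_lmi (K : 'M[R]_(nu, nx)) (P : 'M[R]_nx) (lam : R)
    : 'M[R]_(nx + ((nx + nu) + ((nx + nu) + (nx + ny)))) :=
  block_mx (- (2^-1 *: linL K P)) (R2_col K P)^T
           (R2_col K P)           (R2_diag lam).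

Definition R2_feasible (gam : R) (K : 'M[R]_(nu, nx)) (P : 'M[R]_nx)
    (Z : 'M[R]_nd) (lam : R) : Prop :=
  [/\ 0 <= gam /\ Z^T = Z,
      negdef (R2_lmi K P lam),
      posdef P,
      possemidef (Z - G^T *m P *m G)
    & \tr Z <= gam ^+ 2 /\ 0 < lam].

Variables (free : 'I_nu -> 'I_nx -> bool) (beta : R).

Definition R2_objective (gam : R) (K : 'M[R]_(nu, nx)) : R :=
  gam + beta * frob (hadamard K (maskSc R free)) ^+ 2.

Definition R2_optimal (gam : R) (K : 'M[R]_(nu, nx)) (P : 'M[R]_nx)
    (Z : 'M[R]_nd) (lam : R) : Prop :=
  R2_feasible gam K P Z lam /\
  forall gam' K' P' Z' lam', R2_feasible gam' K' P' Z' lam' ->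
    R2_objective gam K <= R2_objective gam' K'.

End Design.

(* Main.v *)
(** Put [U = delta P] and [V = IK K].  Since
    [H(U^T V) = ((U + V)^T (U + V) - (U - V)^T (U - V)) / 2], the only concave
    terms of (S2) are [- (U - V)^T (U - V) / 2] and, after a Schur complement
    that moves [lam P P] off the diagonal, [- 1 / lam].  (R2) replaces both by
    their tangents at the tilde point.  A tangent overestimates a concave
    function, so the Schur complement of the (R2) block matrix exceeds the (S2)
    matrix by a positive semidefinite one, which vanishes at the tilde point. *)

Require Import Defs.
From mathcomp Require Import all_boot all_order all_algebra.
From mathcomp Require Import all_classical all_reals all_analysis.
From mathcomp Require Import ring lra.
Import Order.TTheory GRing.Theory Num.Theory.
Local Open Scope ring_scope.

(** * Definite matrices and Schur complements *)

Section QuadraticForms.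
Context {R : realType}.

Lemma qformD n (M N : 'M[R]_n) v : qform (M + N) v = qform M v + qform N v.
Proof. by rewrite /qform mulmxDr mulmxDl mxE. Qed.

Lemma qformN n (M : 'M[R]_n) v : qform (- M) v = - qform M v.
Proof. by rewrite /qform mulmxN mulNmx mxE. Qed.

Lemma qformZ n a (M : 'M[R]_n) v : qform (a *: M) v = a * qform M v.
Proof. by rewrite /qform -scalemxAr -scalemxAl mxE. Qed.

Lemma qform0 n (M : 'M[R]_n) : qform M 0 = 0.
Proof. by rewrite /qform mulmx0 mxE. Qed.

Lemma qform_trmul m n (N : 'M[R]_m) (E : 'M[R]_(m, n)) v :
  qform (E^T *m N *m E) v = qform N (E *m v).
Proof. by rewrite /qform trmx_mul !mulmxA. Qed.

Lemma qform1E n (v : 'cV[R]_n) : qform 1%:M v = \sum_i v i 0 ^+ 2.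
Proof.
by rewrite /qform mulmx1 mxE; apply: eq_bigr => i _; rewrite mxE expr2.
Qed.

Lemma qform1_ge0 n (v : 'cV[R]_n) : 0 <= qform 1%:M v.
Proof. by rewrite qform1E sumr_ge0 // => i _; rewrite sqr_ge0. Qed.

Lemma posdef1 n : posdef (1%:M : 'M[R]_n).
Proof.
split=> [|v v0]; first exact: trmx1.
rewrite lt_def qform1_ge0 andbT; apply: contra v0.
rewrite qform1E psumr_eq0 => [/allP h|i _]; last exact: sqr_ge0.
apply/eqP/matrixP => i j; rewrite ord1 mxE.
by apply/eqP; rewrite -sqrf_eq0; apply: h; rewrite mem_index_enum.
Qed.

Lemma qform_gram_ge0 m n (E : 'M[R]_(m, n)) v : 0 <= qform (E^T *m E) v.
Proof. by rewrite -[E^T]mulmx1 qform_trmul qform1_ge0. Qed.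

Lemma posdefZ n a (M : 'M[R]_n) : 0 < a -> posdef M -> posdef (a *: M).
Proof.
move=> a0 [MT M0]; split=> [|v v0]; first by rewrite linearZ /= MT.
by rewrite qformZ mulr_gt0 // M0.
Qed.

Lemma posdef_unitmx n (M : 'M[R]_n) : posdef M -> M \in unitmx.
Proof.
case=> MT M0; rewrite -row_free_unit -kermx_eq0; apply/rowV0P => v /sub_kermxP vM.
apply/eqP; apply/negP => /negP v0.
have : v^T != 0 by rewrite -(inj_eq trmx_inj) trmxK trmx0.
by move/M0; rewrite /qform trmxK vM mul0mx mxE ltxx.
Qed.

Lemma qform_block m n (X : 'M[R]_m) (Y : 'M[R]_(n, m)) (Q : 'M[R]_n) v z :
  qform (block_mx X Y^T Y Q) (col_mx v z)
  = qform X v + 2 * (z^T *m Y *m v) 0 0 + qform Q z.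
Proof.
(* The two cross terms are transposed 1 x 1 matrices, hence the same scalar. *)
have e : v^T *m Y^T *m z = (z^T *m Y *m v)^T by rewrite !trmx_mul trmxK mulmxA.
rewrite /qform tr_col_mx mul_row_block mul_row_col !mulmxDl e !mxE.
by rewrite mulr2n mulrDl mul1r !addrA; lra.
Qed.

Lemma posdef_block_diag m n (X : 'M[R]_m) (Q : 'M[R]_n) :
  posdef X -> posdef Q -> posdef (block_mx X 0 0 Q).
Proof.
move=> [XT X0] [QT Q0]; split=> [|w]; first by rewrite tr_block_mx XT QT !trmx0.
rewrite -[w]vsubmxK; set v := usubmx w; set z := dsubmx w => w0.
have -> : qform (block_mx X 0 0 Q) (col_mx v z) = qform X v + qform Q z.
  have := qform_block _ _ X 0 Q v z; rewrite trmx0 mulmx0 mul0mx => ->.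
  by rewrite [X in 2 * X]mxE mulr0 addr0.
have [v0|v0] := eqVneq v 0; have [z0|z0] := eqVneq z 0.
- by rewrite v0 z0 col_mx0 eqxx in w0.
- by rewrite v0 qform0 add0r Q0.
- by rewrite z0 qform0 addr0 X0.
- by rewrite addr_gt0 ?X0 ?Q0.
Qed.

Lemma negdef_dr m n (X : 'M[R]_m) Y Z (Q : 'M[R]_n) :
  negdef (block_mx X Y Z Q) -> negdef Q.
Proof.
case; rewrite tr_block_mx => /eq_block_mx [_ <- _ QT] M0; split=> // z z0.
have : col_mx (0 : 'cV[R]_m) z != 0.
  by apply: contra z0; rewrite col_mx_eq0 eqxx.
by move/M0; rewrite qform_block qform0 mulmx0 [X in 2 * X]mxE mulr0 !add0r.
Qed.

Lemma negdef_ul m n (X : 'M[R]_m) Y Z (Q : 'M[R]_n) :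
  negdef (block_mx X Y Z Q) -> negdef X.
Proof.
case; rewrite tr_block_mx => /eq_block_mx [XT <- _ _] M0; split=> // v v0.
have : col_mx v (0 : 'cV[R]_n) != 0.
  by apply: contra v0; rewrite col_mx_eq0 eqxx andbT.
by move/M0; rewrite qform_block qform0 trmx0 !mul0mx [X in 2 * X]mxE mulr0 !addr0.
Qed.

(** Completing the square in [z]. The inverse of [Q] enters as a matrix [N] with [Q *m N = 1%:M], so
    that an explicit block diagonal inverse can be supplied. *)
Lemma qform_schur m n (X : 'M[R]_m) (Y : 'M[R]_(n, m)) (Q N : 'M[R]_n) v z :
  Q^T = Q -> Q *m N = 1%:M ->
  qform (block_mx X Y^T Y (- Q)) (col_mx v z)
  = qform (X + Y^T *m N *m Y) v - qform Q (z - N *m Y *m v).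
Proof.
move=> QT QN; rewrite qform_block qformD qformN qform_trmul.
(* By symmetry of [Q], [N^T] is a left inverse; it therefore coincides with the right inverse
   [N]. *)
have NTQ : N^T *m Q = 1%:M by rewrite -[Q]QT -trmx_mul QN trmx1.
have NT : N^T = N by rewrite -[LHS]mulmx1 -QN mulmxA NTQ mul1mx.
rewrite -!mulmxA; move: (Y *m v) => y.
have -> : qform Q (z - N *m y)
    = qform Q z - 2 * (z^T *m y) 0 0 + qform N y.
  have e : y^T *m z = (z^T *m y)^T by rewrite [RHS]trmx_mul trmxK.
  rewrite /qform [(z - _)^T]linearB /= mulmxBl mulmxBl !mulmxBr trmx_mul.
  rewrite -!mulmxA (mulmxA Q N) QN mul1mx (mulmxA N^T Q) NTQ mul1mx e NT.
  move: (z^T *m (Q *m z)) (z^T *m y) (y^T *m (N *m y)) => a b c.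
  by rewrite !mxE; lra.
lra.
Qed.

(** From left to right, test at [z = N *m Y *m v], where the completed square vanishes. Conversely,
    strictness comes from the square if [v = 0] and from the Schur complement otherwise. *)
Lemma negdef_schur m n (X : 'M[R]_m) (Y : 'M[R]_(n, m)) (Q N : 'M[R]_n) :
  X^T = X -> posdef Q -> Q *m N = 1%:M ->
  negdef (block_mx X Y^T Y (- Q)) <-> negdef (X + Y^T *m N *m Y).
Proof.
move=> XT [QT Q0] QN.
have NT : N^T = N.
  by rewrite -[LHS]mulmx1 -QN mulmxA -{1}QT -trmx_mul QN trmx1 mul1mx.
split=> -[_ neg]; split.
- by rewrite linearD /= XT !trmx_mul  trmxK NT mulmxA.
- move=> v v0.
  have /neg : col_mx v (N *m Y *m v) != 0.
    by apply: contra v0; rewrite col_mx_eq0 => /andP[].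
  by rewrite (qform_schur _ _ _ _ _ _ _ _ QT QN) subrr qform0 subr0.
- by rewrite tr_block_mx XT trmxK linearN /= QT.
move=> w; rewrite -[w]vsubmxK; set v := usubmx w; set z := dsubmx w => w0.
rewrite (qform_schur _ _ _ _ _ _ _ _ QT QN).
have [v0|v0] := eqVneq v 0.
  have z0 : z != 0 by apply: contra w0 => /eqP ->; rewrite v0 col_mx0.
  rewrite v0 !mulmx0 subr0 qform0 sub0r oppr_lt0; exact: Q0.
have := neg v v0.
have [->|/Q0] := eqVneq (z - N *m Y *m v) 0; last lra.
by rewrite qform0 subr0.
Qed.

End QuadraticForms.

(** * Comparison of (R2) with (S2) through the Schur complement *)

Section Relaxation.
Variables (R : realType) (nx nu ny : nat).
Variables (bA : 'M[R]_(nx + nu)) (bB : 'M[R]_(nx + nu, nx)).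
Variables (C : 'M[R]_(ny, nx)) (D : 'M[R]_(ny, nu)).
Variables (Kt : 'M[R]_(nu, nx)) (Pt : 'M[R]_nx) (lamt : R).
Hypothesis bA_posdef : posdef bA.

Notation delta := (delta bA bB).

Definition residual (K : 'M[R]_(nu, nx)) (P : 'M[R]_nx) : 'M[R]_(nx + nu, nx) :=
  delta *m P - IK K.

(** With [F] and [W] the residuals at the current and the tilde point, [W^T W + H(W^T (F - W)) = F^T
    F - (F - W)^T (F - W)]: the linearization error is a Gram matrix. *)
Lemma linL_residual K P :
  linL bA bB Kt Pt K P
  = (residual K P)^T *m residual K P
    - (residual K P - residual Kt Pt)^T *m (residual K P - residual Kt Pt).
Proof.
have e : delta *m (P - Pt) - col_mx 0 (K - Kt) = residual K P - residual Kt Pt.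
  have -> : col_mx (0 : 'M[R]_nx) (K - Kt) = IK K - IK Kt.
    by rewrite /IK opp_col_mx add_col_mx subrr.
  by rewrite /residual mulmxBr !opprD !opprK addrACA.
rewrite /linL -/(residual Kt Pt) e /calH.
move: (residual K P) (residual Kt Pt) => F W.
rewrite !trmx_mul trmxK [(F - W)^T]linearB /= !mulmxBl !mulmxBr.
move: (F^T *m F) (F^T *m W) (W^T *m F) (W^T *m W) => a b c e'.
by apply/matrixP => i j; rewrite !mxE; ring.
Qed.

Lemma linL_sym K P : (linL bA bB Kt Pt K P)^T = linL bA bB Kt Pt K P.
Proof. by rewrite linL_residual linearB /= !trmx_mul !trmxK. Qed.

(** The tangent of [1 / lam] at [lamt]; the block [Lambda] is minus this scalar times the
    identity. *)
Definition inv_tangent (lam : R) : R := lamt^-1 - (lamt ^+ 2)^-1 * (lam - lamt).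

Definition R2_schur K P lam : 'M[R]_nx :=
  - (2^-1 *: linL bA bB Kt Pt K P)
  + (2^-1 *: ((delta *m P + IK K)^T *m (delta *m P + IK K))
     + (lam^-1 *: ((IK K)^T *m invmx bA *m IK K)
        + ((inv_tangent lam)^-1 *: (P *m P)
           + (C + D *m K)^T *m (C + D *m K)))).

Lemma R2_lmi_schur K P lam :
  P^T = P -> 0 < lam -> 0 < inv_tangent lam ->
  negdef (R2_lmi bA bB C D Kt Pt lamt K P lam) <-> negdef (R2_schur K P lam).
Proof.
move=> PT lam0 mu0.
(* [Q] is the negated diagonal part of the block matrix and [N] its blockwise inverse. *)
pose Q := block_mx 1%:M 0 0 (block_mx (lam *: bA) 0 0
  (block_mx (inv_tangent lam)%:M 0 0 (1%:M : 'M[R]_ny))) :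
  'M[R]_((nx + nu) + ((nx + nu) + (nx + ny))).
pose N := block_mx 1%:M 0 0 (block_mx (lam^-1 *: invmx bA) 0 0
  (block_mx ((inv_tangent lam)^-1)%:M 0 0 (1%:M : 'M[R]_ny))) :
  'M[R]_((nx + nu) + ((nx + nu) + (nx + ny))).
have eQ : R2_diag ny bA lamt lam = - Q.
  have e : Lambda nx lamt lam = - (inv_tangent lam)%:M.
    by apply/matrixP => i j; rewrite !mxE -mulNrn opprB addrC.
  by rewrite /R2_diag e /Q !opp_block_mx !oppr0.
have QN : Q *m N = 1%:M.
  rewrite /Q /N !mulmx_block !mulmx0 !mul0mx !addr0 !add0r !mulmx1.
  rewrite -scalemxAl -scalemxAr scalerA mulmxV ?posdef_unitmx //.
  by rewrite divff ?gt_eqF // scale1r -scalar_mxM divff ?gt_eqF // -!scalar_mx_block.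
have Qpos : posdef Q.
  apply: posdef_block_diag; first exact: posdef1.
  apply: posdef_block_diag; first exact: posdefZ.
  apply: posdef_block_diag; last exact: posdef1.
  by rewrite -scalemx1; apply: posdefZ => //; exact: posdef1.
rewrite /R2_lmi eQ (negdef_schur _ _ _ _ _ _ _ _ QN) //; last first.
  by rewrite linearN linearZ /= linL_sym.
suff -> : - (2^-1 *: linL bA bB Kt Pt K P)
    + (R2_col bA bB C D K P)^T *m N *m R2_col bA bB C D K P = R2_schur K P lam by [].
rewrite /R2_schur; congr (_ + _).
rewrite /R2_col /N !tr_col_mx !mul_row_block !mulmx0 !addr0 !add0r !mul_row_col.
congr (_ + (_ + (_ + _))).
(* The two factors [1 / sqrt 2] combine into [2^-1]. *)
- rewrite mulmx1 [(_ *: _)^T]linearZ /= -scalemxAl -scalemxAr scalerA -invfM -expr2.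
  by rewrite sqr_sqrtr ?ler0n.
- by rewrite -scalemxAr -scalemxAl.
- by rewrite PT mul_mx_scalar -scalemxAl.
- by rewrite mulmx1.
Qed.

Lemma S2_mx_sym K P lam :
  P^T = P -> (S2_mx bA bB C D K P lam)^T = S2_mx bA bB C D K P lam.
Proof.
move=> PT; have AiT : (invmx bA)^T = invmx bA by rewrite trmx_inv bA_posdef.1.
have trD (X Y : 'M[R]_nx) : (X + Y)^T = X^T + Y^T by exact: linearD.
have trZ a (X : 'M[R]_nx) : (a *: X)^T = a *: X^T by exact: linearZ.
rewrite /S2_mx /calH !trD !trZ trmxK.
congr (_ + _ + _ + _); first exact: addrC.
- by rewrite trmx_mul PT.
- by rewrite !trmx_mul trmxK AiT mulmxA.
- by rewrite trmx_mul trmxK.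
Qed.

(** The subtracted terms are the two linearization errors. The second is written with [P^T *m P], so
    that both are multiples of Gram matrices. *)
Lemma S2_mxE K P lam : P^T = P ->
  S2_mx bA bB C D K P lam
  = R2_schur K P lam
    - (2^-1 *: ((residual K P - residual Kt Pt)^T
                *m (residual K P - residual Kt Pt))
       + ((inv_tangent lam)^-1 - lam) *: (P^T *m P)).
Proof.
move=> PT; rewrite /S2_mx /R2_schur linL_residual.
have -> : calH (P *m delta^T *m IK K)
    = 2^-1 *: ((delta *m P + IK K)^T *m (delta *m P + IK K))
      - 2^-1 *: ((residual K P)^T *m residual K P).
  (* Symmetry of [P] turns [P *m delta^T] into the transpose of [delta *m P], which gives the form
     [U^T V]. *)
  rewrite /calH /residual -{1 2}PT -trmx_mul.
  move: (delta *m P) (IK K) => U V.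
  rewrite trmx_mul trmxK [(U + V)^T]linearD [(U - V)^T]linearB /=.
  rewrite !mulmxDl !mulmxDr !mulNmx !mulmxN.
  move: (U^T *m U) (U^T *m V) (V^T *m U) (V^T *m V) => a b c e.
  by apply/matrixP => i j; rewrite !mxE; field.
rewrite PT.
move: (_^T *m (delta *m P + IK K)) (_^T *m residual K P) (_^T *m (residual K P - _)).
move: (_ *m IK K) (P *m P) (_ *m (C + _)) => a b c f g h.
by apply/matrixP => i j; rewrite !mxE; ring.
Qed.

Lemma inv_tangent_lamt : inv_tangent lamt = lamt^-1.
Proof. by rewrite /inv_tangent subrr mulr0 subr0. Qed.

(** The tangent lies below the convex function [1 / lam]; after multiplication by [lam] the gap is a
    perfect square. *)
Lemma le_inv_inv_tangent lam : 0 < lamt -> 0 < inv_tangent lam -> lam <= (inv_tangent lam)^-1.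
Proof.
move=> lamt0 mu0; rewrite -[(inv_tangent lam)^-1]mul1r ler_pdivlMr // -subr_ge0.
have -> : 1 - lam * inv_tangent lam = ((lam - lamt) / lamt) ^+ 2.
  by rewrite /inv_tangent; field; rewrite gt_eqF.
exact: sqr_ge0.
Qed.

(** (R2) does not state this sign as a separate constraint: it is read off the diagonal block
    [Lambda]. The nonzero [v] ensures that this block is not empty. *)
Lemma R2_lmi_inv_tangent_gt0 K P lam (v : 'cV[R]_nx) :
  negdef (R2_lmi bA bB C D Kt Pt lamt K P lam) -> v != 0 -> 0 < inv_tangent lam.
Proof.
move=> + v0; do 3!move/negdef_dr.
case/negdef_ul=> _ /(_ v v0).
have -> : Lambda nx lamt lam = - inv_tangent lam *: 1%:M.
  by rewrite scalemx1 /inv_tangent opprB addrC.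
by rewrite qformZ mulNr oppr_lt0 pmulr_lgt0 // (posdef1 nx).2.
Qed.

(** At the tilde point both linearization errors vanish, so [R2_schur] equals the (S2) matrix. *)
Lemma R2_lmi_tilde :
  S2_feasible bA bB C D Kt Pt lamt ->
  negdef (R2_lmi bA bB C D Kt Pt lamt Kt Pt lamt).
Proof.
case=> -[PT _] lamt0; rewrite S2_mxE // inv_tangent_lamt invrK !subrr.
rewrite trmx0 mulmx0 scaler0 scale0r addr0 subr0 => neg.
by apply/R2_lmi_schur; rewrite ?inv_tangent_lamt ?invr_gt0.
Qed.

Lemma R2_lmi_S2 K P lam :
  0 < lamt -> posdef P -> 0 < lam ->
  negdef (R2_lmi bA bB C D Kt Pt lamt K P lam) ->
  S2_feasible bA bB C D K P lam.
Proof.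
move=> lamt0 Ppos lam0 lmi; split=> //; have [PT _] := Ppos.
split=> [|v v0]; first exact: S2_mx_sym.
have mu0 := R2_lmi_inv_tangent_gt0 _ _ _ _ lmi v0.
have /(R2_lmi_schur _ _ _ PT lam0 mu0) := lmi; case=> [_ /(_ v v0) neg].
rewrite S2_mxE //; move: (R2_schur K P lam) neg => M neg.
rewrite qformD qformN qformD !qformZ.
apply: le_lt_trans neg; rewrite gerBl addr_ge0 // mulr_ge0 ?qform_gram_ge0 //.
by rewrite subr_ge0 le_inv_inv_tangent.
Qed.

End Relaxation.

Theorem theorem2 (R : realType) (nx nu nd ny T : nat)
  (A : 'M[R]_nx) (B : 'M[R]_(nx, nu)) (G : 'M[R]_(nx, nd))
  (C : 'M[R]_(ny, nx)) (D : 'M[R]_(ny, nu)) (H : 'M[R]_(ny, nd))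
  (hstab : stabilizable A B)
  (x xdot : R -> 'cV[R]_nx) (u : R -> 'cV[R]_nu)
  (d : R -> 'cV[R]_nd) (y : R -> 'cV[R]_ny)
  (htraj : trajectory A B G C D H x xdot u d y)
  (eps : R) (heps : 0 < eps) (hd : forall t : R, 0 < t -> frob (d t) <= eps)
  (ts : 'I_T -> R) (hts : forall i, 0 <= ts i)
  (bA : 'M[R]_(nx + nu)) (bB : 'M[R]_(nx + nu, nx))
  (hAB : logdet_solution G eps (fun i => x (ts i)) (fun i => u (ts i))
           (fun i => xdot (ts i)) bA bB)
  (free : 'I_nu -> 'I_nx -> bool)
  (Kt : 'M[R]_(nu, nx)) (Pt : 'M[R]_nx) (lamt : R)
  (htilde : S2_feasible bA bB C D Kt Pt lamt)
  (beta : R) (hbeta : 0 < beta) :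
  (exists (gam : R) (K : 'M[R]_(nu, nx)) (P : 'M[R]_nx) (Z : 'M[R]_nd)
     (lam : R), R2_feasible bA bB G C D Kt Pt lamt gam K P Z lam) /\
  (forall (gam : R) (K : 'M[R]_(nu, nx)) (P : 'M[R]_nx) (Z : 'M[R]_nd)
     (lam : R),
     R2_optimal bA bB G C D Kt Pt lamt free beta gam K P Z lam ->
     S2_feasible bA bB C D K P lam).
Proof.
have [theta [_ Apos _] _] := hAB.
have [Ppos lamt0 _] := htilde.
split; last first.
  move=> gam K P Z lam [[_ lmi P0 _ [_ lam0]] _].
  exact: R2_lmi_S2 lmi.
pose Z := G^T *m Pt *m G.
(* This [Z] turns its matrix inequality into an equality, and [gam] satisfies the trace bound
   because [t <= (1 + t) ^+ 2] for [t >= 0]. *)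
exists (1 + `|\tr Z|), Kt, Pt, Z, lamt; split=> //.
- by split; rewrite ?addr_ge0 // /Z !trmx_mul trmxK Ppos.1 mulmxA.
- exact: R2_lmi_tilde.
- by rewrite subrr; split=> [|v]; rewrite ?trmx0 // /qform mulmx0 mul0mx mxE.
- split=> //; apply: le_trans (ler_norm _) _.
  by have := normr_ge0 (\tr Z); nra.
Qed.
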